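(* Let $(X,T)$ be a topological dynamical system and let $\mathcal{E}\colon\mathcal{M}(X)\to\mathbb{R}$ be an energy. Then each of the following equals $\underline{P}(T,\mathcal{E})$: (i) $\underline{Q}(T,\mathcal{E})$; (ii) $\lim_{\delta\to0}\sup\{\underline{P}_i(T,\mathcal{E};\mathcal{U}):\mathcal{U}\in\mathcal{C}_X^o,\ \mathrm{diam}(\mathcal{U})\le\delta\}$, for every $i\in\{1,2,3,4\}$; (iii) $\lim_{k\to\infty}\underline{P}_i(T,\mathcal{E};\mathcal{U}_k)$, for every sequence $\{\mathcal{U}_k\}\subset\mathcal{C}_X^o$ with $\mathrm{diam}(\mathcal{U}_k)\to0$ and every $i\in\{1,2,3,4\}$; (iv) $\sup_{\mathcal{U}\in\mathcal{C}_X^o}\underline{P}_i(T,\mathcal{E};\mathcal{U})$, for every $i\in\{1,2,4\}$.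
   Context: A topological dynamical system (TDS) is a pair $(X,T)$ with $X$ a compact metric space (metric $d$) and $T:X\to X$ a continuous surjection. $\mathcal{M}(X)$ is the set of Borel probability measures on $X$ with the weak-star topology. An energy is a weak-star continuous function $\mathcal{E}\colon\mathcal{M}(X)\to\mathbb{R}$. For $x\in X$, $n\ge1$, $\triangle_x^n=\frac1n\sum_{i=0}^{n-1}\delta_{T^ix}$. Let $B_n(x,\varepsilon)=\{y\in X:d(T^ix,T^iy)<\varepsilon,\ 0\le i\le n-1\}$. A set $E\subset X$ is $(n,\varepsilon)$-separated if $y\notin B_n(x,\varepsilon)$ for all distinct $x,y\in E$; a set $F\subset X$ is $(n,\varepsilon)$-spanning if for every $x\in X$ there is $y\in F$ with $y\in B_n(x,\varepsilon)$. Let $P_n(T,\mathcal{E},\varepsilon)$ be the supremum of $\sum_{x\in E}e^{n\mathcal{E}(\triangle_x^n)}$ over $(n,\varepsilon)$-separated sets $E$ of $X$, and $Q_n(T,\mathcal{E},\varepsilon)$ the infimum of $\sum_{x\in F}e^{n\mathcal{E}(\triangle_x^n)}$ over $(n,\varepsilon)$-spanning sets $F$ of $X$. Define $$\underline{P}(T,\mathcal{E})=\lim_{\varepsilon\to0}\liminf_{n\to\infty}\tfrac1n\log P_n(T,\mathcal{E},\varepsilon),\qquad \underline{Q}(T,\mathcal{E})=\lim_{\varepsilon\to0}\liminf_{n\to\infty}\tfrac1n\log Q_n(T,\mathcal{E},\varepsilon).$$ A cover of $X$ is a finite collection of Borel subsets with union $X$; $\mathcal{C}_X$ and $\mathcal{C}_X^o$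 denote the sets of covers and of open covers (covers consisting of open sets). $\mathcal{V}\succeq\mathcal{W}$ means each element of $\mathcal{V}$ is contained in some element of $\mathcal{W}$. $\mathcal{U}\vee\mathcal{V}=\{U\cap V: U\in\mathcal{U},V\in\mathcal{V}\}$, $\mathcal{U}_0^{n-1}=\bigvee_{i=0}^{n-1}T^{-i}\mathcal{U}$, and $\mathrm{diam}(\mathcal{U})$ is the maximum of the diameters of the elements of $\mathcal{U}$. For $\mathcal{U}\in\mathcal{C}_X^o$ and $n\ge1$ let $$p_n^1(T,\mathcal{E};\mathcal{U})=\inf\Big\{\sum_{V\in\mathcal{V}}\sup_{x\in V}e^{n\mathcal{E}(\triangle_x^n)}:\mathcal{V}\in\mathcal{C}_X,\ \mathcal{V}\succeq\mathcal{U}_0^{n-1}\Big\},$$ $$p_n^2(T,\mathcal{E};\mathcal{U})=\inf\Big\{\sum_{V\in\mathcal{V}}\inf_{x\in V}e^{n\mathcal{E}(\triangle_x^n)}:\mathcal{V}\in\mathcal{C}_X,\ \mathcal{V}\succeq\mathcal{U}_0^{n-1}\Big\},$$ $$p_n^3(T,\mathcal{E};\mathcal{U})=\inf\Big\{\sum_{B\in\beta}\sup_{x\in B}e^{n\mathcal{E}(\triangle_x^n)}:\beta\text{ a finite subcover of }\mathcal{U}_0^{n-1}\Big\},$$ $$p_n^4(T,\mathcal{E};\mathcal{U})=\inf\Big\{\sum_{B\in\beta}\inf_{x\in B}e^{n\mathcal{E}(\triangle_x^n)}:\beta\text{ a finite subcover of }\mathcal{U}_0^{n-1}\Big\},$$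 and $\underline{P}_i(T,\mathcal{E};\mathcal{U})=\liminf_{n\to\infty}\frac1n\log p_n^i(T,\mathcal{E};\mathcal{U})$ for $i=1,2,3,4$. *)

(* Defs.v *)
From HB Require Import structures.
From mathcomp Require Export all_boot all_order all_algebra.
From mathcomp Require Export all_classical all_reals all_analysis.

Set Implicit Arguments.
Unset Strict Implicit.
Unset Printing Implicit Defensive.

Export Order.TTheory GRing.Theory Num.Theory.
Export numFieldNormedType.Exports.

Set Warnings "-redundant-canonical-projection".

Local Open Scope classical_set_scope.
Local Open Scope ring_scope.

(* The library's measurable types are pointed, so the metric space has to be
   pointed (that is, nonempty) for its Borel sigma-algebra to be available. *)
#[short(type="pmetricType")]
HB.structure Definition PointedMetric (K : numDomainType) :=
  {M of Metric K M & Pointed M}.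

Definition borel (X : ptopologicalType) := g_sigma_algebraType (@open X).

HB.instance Definition _ (X : ptopologicalType) := Measurable.on (borel X).

Section weak_star.
Context {R : realType} (X : pmetricType R).

Definition integrate (mu : probability (borel X) R) :
    {ptws continuousType X R -> R} :=
  fun f => (\int[mu]_x (f x))%R.

(* Borel probability measures with the coarsest topology making
   mu |-> \int[mu] f continuous for every continuous f : X -> R. *)
Definition prob_space := initial_topology integrate.

HB.instance Definition _ := Topological.on prob_space.

End weak_star.
Arguments prob_space {R} X.

Section empirical.
Context {R : realType} {X : pmetricType R} (T : X -> X) (n : nat) (x : X).

(* 1/n \sum_(i < n) \d_(T^i x) for n >= 1. Writing n.-1.+1 for n makes this a
   probability for every n; the junk value at n = 0 is never relevant, because
   n only occurs under a limit inferior below. *)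
Definition empirical : set (borel X) -> \bar R :=
  mscale (n.-1.+1%:R^-1)%:nng
    (msum (fun i => dirac (iter i T x : borel X)) n.-1.+1).

HB.instance Definition _ := Measure.on empirical.

Let empirical_setT : empirical [set: borel X] = 1%E.
Proof.
rewrite /empirical /mscale/= /msum.
rewrite (eq_bigr (fun=> 1%:E)) => [|i _]; last exact: probability_setT.
by rewrite sumEFin -EFinM sumr_const card_ord mulVf.
Qed.

HB.instance Definition _ :=
  Measure_isProbability.Build _ _ _ empirical empirical_setT.

Definition empirical_prob : prob_space X := (empirical : probability (borel X) R).

End empirical.

Section pressure.
Context {R : realType} {X : pmetricType R}.
Variables (T : X -> X) (E : prob_space X -> R).

Local Open Scope ereal_scope.

Definition weight (n : nat) (x : X) : \bar R :=
  (expR (n%:R * E (empirical_prob T n x)))%:E.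

Definition lower_rate (u : nat -> \bar R) : \bar R :=
  limn_einf (fun n => (n%:R^-1)%:E * lne (u n)).

Definition bowen_ball (n : nat) (eps : R) (x : X) : set X :=
  [set y | forall i, (i < n)%N -> (mdist (iter i T x) (iter i T y) < eps)%R].

Definition separated (n : nat) (eps : R) (A : set X) : Prop :=
  forall x y, A x -> A y -> x <> y -> ~ bowen_ball n eps x y.

Definition spanning (n : nat) (eps : R) (F : set X) : Prop :=
  forall x, exists2 y, F y & bowen_ball n eps x y.

Definition Psep (eps : R) (n : nat) : \bar R :=
  ereal_sup [set \esum_(x in A) weight n x | A in separated n eps].

Definition Qspan (eps : R) (n : nat) : \bar R :=
  ereal_inf [set \esum_(x in F) weight n x | F in spanning n eps].

Definition lower_P : \bar R := lim (lower_rate (Psep eps) @[eps --> 0%R^'+]).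

Definition lower_Q : \bar R := lim (lower_rate (Qspan eps) @[eps --> 0%R^'+]).

Definition is_cover (U : set (set X)) : Prop :=
  [/\ finite_set U,
      forall A, U A -> measurable (A : set (borel X)) &
      \bigcup_(A in U) A = [set: X]].

Definition is_open_cover (U : set (set X)) : Prop :=
  is_cover U /\ forall A, U A -> open A.

Definition refines (V W : set (set X)) : Prop :=
  forall A, V A -> exists2 B, W B & A `<=` B.

Definition join (U V : set (set X)) : set (set X) :=
  [set A `&` B | A in U & B in V].

(* The join of the T^-i U for i < n. *)
Definition iter_join (U : set (set X)) (n : nat) : set (set X) :=
  \big[join/[set [set: X]]]_(i < n) [set iter i T @^-1` A | A in U].

Definition is_subcover (U beta : set (set X)) : Prop :=
  beta `<=` U /\ \bigcup_(B in beta) B = [set: X].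

(* Real suprema, with sup set0 = 0; the sets involved are bounded when X is
   compact. *)
Definition diam (A : set X) : R := sup [set mdist x y | x in A & y in A].

Definition cover_diam (U : set (set X)) : R := sup [set diam A | A in U].

(* The weights lie in [0, +oo], in which the supremum of the empty set is 0 and
   its infimum is +oo. *)
Definition sup_weight (n : nat) (A : set X) : \bar R :=
  maxe 0 (ereal_sup [set weight n x | x in A]).

Definition inf_weight (n : nat) (A : set X) : \bar R :=
  ereal_inf [set weight n x | x in A].

Definition p1 (U : set (set X)) (n : nat) : \bar R :=
  ereal_inf [set \sum_(A \in V) sup_weight n A |
    V in [set V | is_cover V /\ refines V (iter_join U n)]].

Definition p2 (U : set (set X)) (n : nat) : \bar R :=
  ereal_inf [set \sum_(A \in V) inf_weight n A |
    V in [set V | is_cover V /\ refines V (iter_join U n)]].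

Definition p3 (U : set (set X)) (n : nat) : \bar R :=
  ereal_inf [set \sum_(B \in beta) sup_weight n B |
    beta in [set beta | finite_set beta /\ is_subcover (iter_join U n) beta]].

Definition p4 (U : set (set X)) (n : nat) : \bar R :=
  ereal_inf [set \sum_(B \in beta) inf_weight n B |
    beta in [set beta | finite_set beta /\ is_subcover (iter_join U n) beta]].

Inductive variant := v1 | v2 | v3 | v4.

Definition pcover (i : variant) : set (set X) -> nat -> \bar R :=
  match i with v1 => p1 | v2 => p2 | v3 => p3 | v4 => p4 end.

Definition lower_Pcover (i : variant) (U : set (set X)) : \bar R :=
  lower_rate (pcover i U).

End pressure.

(* Main.v *)
From HB Require Import structures.
From mathcomp Require Import finmap ring lra measurable_realfun.
Require Import Defs.

(* For an open cover U of diameter less than eps, with Lebesgue number lam,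
     P_n(eps) <= p^1_n(U) <= p^3_n(U) <= e^(n eta) p^2_n(U)
              <= e^(n eta) p^4_n(U) <= e^(n eta) Q_n(lam) <= e^(n eta) P_n(lam),
   where eta bounds the variation of the energy on empirical measures of orbits
   that stay eps-close. The first inequality holds because an element of the
   n-th join of U contains at most one point of an (n, eps)-separated set, the
   last one because a maximal separated set is spanning. Everything follows
   once eta can be taken arbitrarily small with eps.

   That uniform continuity needs limits of empirical measures in M(X). Lift
   orbits to the Cantor space through a continuous surjection g onto X; along an
   ultrafilter, the masses of cylinders converge to a consistent family nu.
   Splitting [0, 1[ into nested intervals of lengths nu w codes each t in [0, 1[
   by a point of the Cantor space, and the law of its image under g is the
   limit measure. *)

Local Open Scope classical_set_scope.
Local Open Scope ring_scope.

(** * Probability measures with prescribed masses on cylinders *)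

(* The first n bits of c, the latest one at the head. *)
Fixpoint rprefix (c : nat -> bool) (n : nat) : seq bool :=
  if n is m.+1 then c m :: rprefix c m else [::].

(** A sample point of the cylinder of [w]: the word is reversed because its head is the latest bit,
    and all further bits are [false]. *)
Definition extend (w : seq bool) : nat -> bool := nth false (rev w).

Lemma size_rprefix c n : size (rprefix c n) = n.
Proof. by elim: n => //= n ->. Qed.

Lemma rprefixP c c' n :
  rprefix c n = rprefix c' n <-> forall i, (i < n)%N -> c i = c' i.
Proof.
elim: n => [//|n IH] /=; split=> [[cc' /IH {}IH] i|cc'].
  by rewrite ltnS leq_eqVlt => /orP[/eqP ->//|/IH].
by rewrite cc'//; congr cons; apply/IH => i iltn; rewrite cc'// ltnS ltnW.
Qed.

Lemma rprefix_extend w : rprefix (extend w) (size w) = w.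
Proof.
elim: w => //= b w IH; congr cons.
  by rewrite /extend rev_cons nth_rcons size_rev ltnn eqxx.
rewrite -[RHS]IH; apply/rprefixP => i iw.
by rewrite /extend rev_cons nth_rcons size_rev iw.
Qed.

Lemma extend_rprefix c n : rprefix (extend (rprefix c n)) n = rprefix c n.
Proof. by have := rprefix_extend (rprefix c n); rewrite size_rprefix. Qed.

(** * Coding of the unit interval by nested intervals *)

Section unit_interval.
Context {R : realType}.

Definition leb01 : set (measurableTypeR R) -> \bar R :=
  mrestr (@lebesgue_measure R) (measurable_itv (`[0, 1[ : interval R)).

HB.instance Definition _ := Measure.on leb01.

Let leb01_setT : leb01 [set: R] = 1%E.
Proof.
by rewrite /leb01 /mrestr setTI lebesgue_measure_itv/= lte_fin ltr01 oppr0 adde0.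
Qed.

HB.instance Definition _ :=
  Measure_isProbability.Build _ _ _ leb01 leb01_setT.

End unit_interval.

Section coding.
Context {R : realType} (nu : seq bool -> R).
Hypothesis nu_ge0 : forall w, 0 <= nu w.
Hypothesis nu_nil : nu [::] = 1.
Hypothesis nu_cons : forall w, nu w = nu (false :: w) + nu (true :: w).

Fixpoint left_end (w : seq bool) : R :=
  if w is b :: w' then left_end w' + (if b then nu (false :: w') else 0) else 0.

Fixpoint code (t : R) (n : nat) : seq bool :=
  if n is m.+1 then
    (left_end (code t m) + nu (false :: code t m) <= t) :: code t m
  else [::].

Definition bits (t : R) : cantor_space :=
  fun n => left_end (code t n) + nu (false :: code t n) <= t.

Lemma rprefix_bits t n : rprefix (bits t) n = code t n.
Proof. by elim: n => //= n ->. Qed.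

(* The word w receives the interval of length nu w starting at left_end w, so
   that code t n is the word of length n whose interval contains t. *)
Lemma codeP w t : (code t (size w) = w /\ 0 <= t < 1) <->
  left_end w <= t < left_end w + nu w.
Proof.
elim: w => [|b w IH] /=; first by rewrite add0r nu_nil; split=> [[]|].
(* By [nu_cons] the intervals of the two extensions fill that of [w], so once the next bit of [t] is
   known to be [b], lying in the interval of [w] or in that of [b :: w] is the same. *)
have Hw : (left_end w + nu (false :: w) <= t) = b ->
    (left_end w <= t < left_end w + nu w) =
    (left_end w + (if b then nu (false :: w) else 0) <= t <
     left_end w + (if b then nu (false :: w) else 0) + nu (b :: w)).
  have n0 := nu_ge0 (false :: w); have n1 := nu_ge0 (true :: w).
  rewrite (nu_cons w); case: b => [H|/negbT]; rewrite ?addr0 ?addrA ?H /=.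
    have -> // : left_end w <= t by rewrite (le_trans _ H)// lerDl.
  rewrite -ltNge => H; rewrite H andbT andbC -[RHS]andTb; congr (_ && _).
  by rewrite (lt_le_trans H)// lerDl.
split.
  case=> -[ub uw] t01; rewrite -Hw; first by apply/IH.
  by rewrite -{1 2}uw.
move=> H; have bE : (left_end w + nu (false :: w) <= t) = b.
  move: H; case: b {Hw} => /andP[]; first by [].
  by rewrite addr0 ltNge => _ /negbTE.
move: H; rewrite -Hw// => /IH[uw t01]; split=> //.
by rewrite uw bE.
Qed.

Lemma measurable_code (w : seq bool) : measurable [set t | code t (size w) = w].
Proof.
elim: w => [|b w IH] /=.
  rewrite (_ : [set _ | _] = setT)//.
  by apply/seteqP; split.
rewrite (_ : [set _ | _] = [set t | code t (size w) = w] `&`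
    [set t | (left_end w + nu (false :: w) <= t) = b]); last first.
  apply/seteqP; split=> t /= [E1 E2]; last by rewrite E1 E2.
  by split=> //; rewrite -E1 E2.
apply: measurableI => //; case: b.
  rewrite (_ : [set _ | _] = `[left_end w + nu (false :: w), +oo[%classic)//.
  by apply/seteqP; split=> t /=; rewrite in_itv/= andbT.
rewrite (_ : [set _ | _] = `]-oo, left_end w + nu (false :: w)[%classic)//.
by apply/seteqP; split=> t /=; rewrite in_itv/= ltNge; [move=> ->|move=> /negbTE].
Qed.

Lemma leb01_code w : leb01 [set t | code t (size w) = w] = (nu w)%:E.
Proof.
rewrite /leb01 /mrestr (_ : _ `&` _ = `[left_end w, left_end w + nu w[%classic).
  (* If [nu w = 0] the interval is empty and the length formula takes its default value 0. *)
  rewrite lebesgue_measure_itv/= lte_fin ltrDl lt_neqAle nu_ge0 andbT.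
  by case: eqVneq => [<-//|_] /=; rewrite -EFinD addrAC subrr add0r.
apply/seteqP; split=> t /=; rewrite !in_itv/=; last by move/codeP.
by move=> ?; apply/codeP.
Qed.

End coding.

(** * Cylinders in the Cantor space *)

Lemma nbhs_cylinderP (c : cantor_space) (A : set cantor_space) :
  nbhs c A <-> exists n, [set c' | rprefix c' n = rprefix c n] `<=` A.
Proof.
split=> [cA|[n /filterS]]; last apply.
  (* The filter of cylinders around [c] converges to [c]: a subbasic open set constrains one
     coordinate [i], which the first [i.+1] bits decide. *)
  pose F := filter_from [set: nat]
    (fun n => [set c' : cantor_space | rprefix c' n = rprefix c n]).
  have FF : Filter F.
    apply: filter_from_filter => [|i j _ _]; first by exists 0%N.
    exists (maxn i j) => // c' /= /rprefixP cc'.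
    by split; apply/rprefixP => k ki; apply: cc'; rewrite leq_max ki ?orbT.
  suff : F --> c by move=> /(_ _ cA)[n _ nA]; exists n.
  apply/cvg_sup => i U [V] [[W] oW <-] Wc WU.
  exists i.+1 => // c' /= [cc' _]; apply: WU.
  by rewrite /= /prod_topology/= [c' i]cc'.
elim: n => [|n IH]; first exact: filterS filterT.
have nbhs_n : nbhs c [set c' : cantor_space | c' n = c n].
  apply: (@proj_continuous nat (fun=> bool) n c [set c n]).
  exact: discrete_set1.
by apply: filterS2 IH nbhs_n => c' /= -> ->.
Qed.

(** Around each [c] some length [n0] keeps [h] within [e / 2] of [h c]; compactness, in its
    near-covering form, yields lengths valid for all points. *)
Lemma cantor_unif_continuous {R : realType} (h : cantor_space -> R) (e : R) :
  continuous h -> 0 < e ->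
  \forall n \near \oo, forall c c' : cantor_space,
    rprefix c n = rprefix c' n -> `|h c - h c'| <= e.
Proof.
move=> ch e0; have /compact_near_coveringP K := cantor_space_compact.
have := K nat \oo (fun n c => forall c' : cantor_space,
  rprefix c n = rprefix c' n -> `|h c - h c'| <= e) _ _.
move=> /(_ _ _)[c _|n _ H]; last by exists n => // m /H + c c'; apply.
have /nbhs_cylinderP[n0 Hn0] : nbhs c [set c' | `|h c - h c'| <= e / 2].
  have /cvgrPdist_le := ch c; apply; exact: divr_gt0.
exists ([set c' | rprefix c' n0 = rprefix c n0], [set n | (n0 <= n)%N]).
  split=> /=; last by exists n0.
  by apply/nbhs_cylinderP; exists n0.
move=> [c1 n] /= [c1c n0n] c' /rprefixP c1c'.
have c'c : rprefix c' n0 = rprefix c n0.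
  by rewrite -c1c; apply/rprefixP => i i0; rewrite c1c'// (leq_trans i0).
rewrite (le_trans (ler_distD (h c) _ _))// (splitr e) lerD//.
  by rewrite distrC; exact: Hn0.
exact: Hn0.
Qed.

Lemma measurable_borel (X : ptopologicalType) d (S : measurableType d)
    (f : S -> X) :
  (forall G : set X, open G -> measurable (f @^-1` G)) ->
  measurable_fun [set: S] (f : S -> borel X).
Proof.
move=> mf; apply: (@measurability _ _ S (borel X) setT f (@open X)) => // _ [G oG <-].
by rewrite setTI; exact: mf.
Qed.

Lemma continuous_borel_measurable {R : realType} (X : ptopologicalType)
    (f : X -> R) :
  continuous f -> measurable_fun [set: borel X] (f : borel X -> R).
Proof.
move=> /continuousP cf.
apply: (@measurability _ _ (borel X) R setT f _ (RGenOpens.measurableE R)).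
move=> _ [_ [a [b ->] <-]]; rewrite setTI; apply: sub_sigma_algebra.
exact/cf/interval_open.
Qed.

(** Serves to write a function of the first [n] bits as a combination of indicators of cylinders. *)
Lemma sum_tuple_eq {R : realType} (n : nat) (a : seq bool -> R) (u : seq bool) :
  size u = n -> \sum_(w : n.-tuple bool) a w * (u == w)%:R = a u.
Proof.
move=> /eqP un; rewrite (bigD1 (Tuple un))//= eqxx mulr1 big1 ?addr0// => w.
by rewrite eq_sym -val_eqE/= => /negbTE ->; rewrite mulr0.
Qed.

Section law.
Context {R : realType} {X : pmetricType R} d (S : measurableType d)
  (P : probability S R) (b : S -> cantor_space) (g : cantor_space -> X).
Hypothesis mb : forall w, measurable [set t | rprefix (b t) (size w) = w].
Hypothesis cg : continuous g.

Let Y (t : S) : X := g (b t).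

Let measurable_Y : measurable_fun [set: S] (Y : S -> borel X).
Proof.
apply: measurable_borel => G oG.
(* [g] pulls [G] back to a union of cylinders, and there are only countably many words. *)
rewrite (_ : Y @^-1` G = \bigcup_w
  (if `[< forall c : cantor_space, rprefix c (size w) = w -> G (g c) >]
   then [set t | rprefix (b t) (size w) = w] else set0)).
  apply: countable_bigcupT_measurable => [|w]; first exact: countableP.
  by case: asboolP => _; [exact: mb|exact: measurable0].
apply/seteqP; split=> [t Gt|t [w _]].
  have : nbhs (b t) (g @^-1` G) by apply: cg; exact: open_nbhs_nbhs.
  move=> /nbhs_cylinderP[n nG]; exists (rprefix (b t) n) => //.
  case: asboolP => [_|[]]; first by rewrite /= size_rprefix.
  by move=> c; rewrite size_rprefix => /nG.
by case: asboolP => // wG /= tw; exact: wG.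
Qed.

Let RV : {mfun S >-> borel X} := mfun_Sub (mem_set measurable_Y).

(** The measure is the law of [g (b t)]. On long cylinders [f \o g] varies by at most [e], so
    sampling it at [extend w] turns the integral into a finite sum of masses. *)
Lemma law_of_code : exists mu : probability (borel X) R,
  forall f : X -> R, continuous f -> forall e : R, 0 < e ->
  \forall n \near \oo,
    `|(\int[mu]_x f x)%R - \sum_(w : n.-tuple bool)
        fine (P [set t | rprefix (b t) n = w]) * f (g (extend w))|
    <= e.
Proof.
exists (distribution P RV) => f cf e e0.
have cfg : continuous (f \o g).
  by move=> c; apply: continuous_comp; [exact: cg|exact: cf].
near=> n.
have unif c c' : rprefix c n = rprefix c' n -> `|f (g c) - f (g c')| <= e.
  by move: c c'; near: n; exact: cantor_unif_continuous cfg e0.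
pose a (w : seq bool) : R := f (g (extend w)).
pose h (t : S) : R :=
  \sum_(w : n.-tuple bool) a w * \1_[set t | rprefix (b t) n = w] t.
have hE t : h t = a (rprefix (b t) n).
  rewrite -[RHS](@sum_tuple_eq _ n) ?size_rprefix//.
  apply: eq_bigr => w _; rewrite indicE.
  by congr (_ * (nat_of_bool _)%:R); apply/idP/eqP; rewrite inE.
have mcode (w : n.-tuple bool) : measurable [set t | rprefix (b t) n = w].
  by have := mb w; rewrite size_tuple.
have mf : measurable_fun [set: borel X] (f : borel X -> R).
  exact: continuous_borel_measurable.
have fY t : `|f (Y t) - h t| <= e.
  by rewrite hE; apply: unif; rewrite extend_rprefix.
have term_int (w : n.-tuple bool) :
    P.-integrable setT (EFin \o (fun t => a w * \1_[set t | rprefix (b t) n = w] t)).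
  rewrite (_ : _ \o _ =
    (fun t => (a w)%:E * (\1_[set t | rprefix (b t) n = w] t)%:E)%E)//.
  apply: integrableZl => //.
  exact: integrable_indic.
have int_h : P.-integrable setT (EFin \o h).
  rewrite (_ : _ \o _ = (fun t => \sum_(w : n.-tuple bool)
     (a w * \1_[set t | rprefix (b t) n = w] t)%:E)%E).
    by apply: (integrable_sum measurableT) => w _; exact: term_int.
  by apply/funext => t; rewrite /= /h sumEFin.
have int_fY : P.-integrable setT (EFin \o (f \o Y)).
  apply: measurable_bounded_integrable => //.
  - by rewrite (le_lt_trans (probability_le1 _ _))// ltry.
  - exact: (measurableT_comp mf measurable_Y).
  - have : compact ((f \o g) @` [set: cantor_space]).
      apply: continuous_compact; last exact: cantor_space_compact.
      exact: continuous_subspaceT.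
    move=> /compact_bounded[M [Mreal HM]]; exists M; split=> // r Mr t _.
    by apply: HM Mr _ _; exists (b t).
have -> : (\int[distribution P RV]_x f x)%R = (\int[P]_t f (Y t))%R.
  have mEf : measurable_fun [set: borel X] (fun x : borel X => (f x)%:E).
    exact/measurable_EFinP.
  congr fine.
  exact: (integral_pushforward measurable_Y mEf int_fY measurableT).
have -> : \sum_(w : n.-tuple bool)
    fine (P [set t | rprefix (b t) n = w]) * f (g (extend w)) =
    (\int[P]_t h t)%R.
  rewrite /Rintegral (eq_integral (fun t => \sum_(w : n.-tuple bool)
     (a w * \1_[set t | rprefix (b t) n = w] t)%:E)%E); last first.
    by move=> t _; rewrite /h sumEFin.
  rewrite integral_sum// -[LHS]/(fine (_%:E)) -sumEFin; congr fine.
  apply: eq_bigr => w _; rewrite mulrC.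
  under eq_integral do rewrite EFinM.
  rewrite integralZl//; last exact: integrable_indic.
  by rewrite integral_indic// setIT EFinM fineK// fin_num_measure.
have int_B : P.-integrable setT (EFin \o (fun t => f (Y t) - h t)).
  rewrite (_ : EFin \o _ = ((EFin \o (f \o Y)) \- (EFin \o h))%E)//.
  exact: integrableB.
rewrite -RintegralB// (le_trans (le_normr_Rintegral _ _))//.
rewrite (@le_trans _ _ (\int[P]_t e)%R)//.
  apply: le_Rintegral => //.
    exact: (integrable_abse int_B).
  exact: finite_measure_integrable_cst.
by rewrite Rintegral_cst//= probability_setT/= mulr1.
Unshelve. all: by end_near. Qed.

End law.

(** By [leb01_code], the bits of a uniformly distributed number have cylinder masses [nu]; the
    measure is the law of their image under [g]. *)
Lemma law_of_masses {R : realType} {X : pmetricType R} (nu : seq bool -> R)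
    (g : cantor_space -> X) :
  (forall w, 0 <= nu w) -> nu [::] = 1 ->
  (forall w, nu w = nu (false :: w) + nu (true :: w)) -> continuous g ->
  exists mu : probability (borel X) R,
  forall f : X -> R, continuous f -> forall e : R, 0 < e ->
  \forall n \near \oo,
    `|(\int[mu]_x f x)%R - \sum_(w : n.-tuple bool) nu w * f (g (extend w))|
    <= e.
Proof.
move=> nu0 nu1 nuS cg.
have setE n (w : seq bool) : [set t | rprefix (bits nu t) n = w] =
    [set t | code nu t n = w].
  by apply/seteqP; split=> t /=; rewrite rprefix_bits.
have mb w : measurable
    [set t : measurableTypeR R | rprefix (bits nu t) (size w) = w].
  by rewrite setE; exact: measurable_code.
have [mu Hmu] := law_of_code _ _ (@leb01 R) (bits nu) g mb cg.
exists mu => f cf e e0; apply: filterS (Hmu f cf e e0) => n.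
rewrite (eq_bigr (fun w : n.-tuple bool => nu w * f (g (extend w))))// => w _.
have := leb01_code nu nu0 nu1 nuS w; rewrite size_tuple => nuw.
by rewrite setE [X in fine X]nuw.
Qed.

(** * Convergence along ultrafilters and integrals of empirical measures *)

Lemma ultra_fmap {I J : Type} (U : set_system I) (h : I -> J) :
  UltraFilter U -> UltraFilter (h @ U).
Proof.
move=> UU; split; first exact: fmap_proper_filter.
move=> G GF hUG; rewrite eqEsubset; split=> // A GA.
(* If the image of [U] missed [A], it would contain the complement of [A], and [G] would contain
   both. *)
have [//|UnA] := in_ultra_setVsetC (h @^-1` A) UU.
have GnA : G (~` A) by exact: hUG.
have := filter_not_empty G; rewrite -(setICr A); case.
exact: filterI.
Qed.

Lemma ultra_bounded_cvg {R : realType} {I : Type} (U : set_system I)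
    (h : I -> R) (a b : R) : UltraFilter U -> (forall i, a <= h i <= b) ->
  cvg (h @ U).
Proof.
move=> UU hab; have := @segment_compact R a b; rewrite compact_ultra.
move=> /(_ (h @ U) (ultra_fmap U h UU))[|l [_ hl]]; last by apply/cvg_ex; exists l.
by apply: (@filterS _ U _ setT); [move=> i _; rewrite /= in_itv/=|exact: filterT].
Qed.

Section empirical_integral.
Context {R : realType} {X : pmetricType R} (T : X -> X) (n : nat) (x : X).

Let ge0_integral_empirical (f : borel X -> \bar R) :
  measurable_fun setT f -> (forall y, 0 <= f y)%E ->
  (\int[empirical T n x]_y f y =
   (n.-1.+1%:R^-1)%:E * \sum_(j < n.-1.+1) f (iter j T x))%E.
Proof.
move=> mf f0; rewrite ge0_integral_mscale//= ge0_integral_measure_sum//.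
by congr (_ * _)%E; apply: eq_bigr => j _; rewrite integral_dirac// diracT mul1e.
Qed.

Lemma integral_empirical (f : X -> R) : continuous f ->
  (\int[empirical T n x]_y f y)%R =
  n.-1.+1%:R^-1 * \sum_(j < n.-1.+1) f (iter j T x).
Proof.
move=> cf; have mf : measurable_fun [set: borel X] (fun y : borel X => (f y)%:E).
  by apply/measurable_EFinP; exact: continuous_borel_measurable.
(* The positive and negative parts are integrated apart, each as a nonnegative function, and
   recombine at each orbit point. *)
rewrite /Rintegral integralE !ge0_integral_empirical//; last 2 first.
- exact: measurable_funeneg.
- exact: measurable_funepos.
rewrite (eq_bigr (fun j : 'I_ _ => (Num.max (f (iter j T x)) 0)%:E)); last first.
  by move=> j _; rewrite funeposE EFin_max.
rewrite [X in (_ - _ * X)%E](eq_bigr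
  (fun j : 'I_ _ => (Num.max (- f (iter j T x)) 0)%:E)); last first.
  by move=> j _; rewrite funenegE EFin_max.
rewrite !sumEFin -!EFinM -EFinB/= -mulrBr -sumrB; congr (_ * _).
apply: eq_bigr => j _; have [f0|/ltW f0] := leP 0 (f (iter j T x)).
  by rewrite (max_idPr _) ?subr0// oppr_le0.
by rewrite (max_idPl _) ?sub0r ?opprK// oppr_ge0.
Qed.

End empirical_integral.

(** * Limits of empirical measures *)

(** The weak-star topology is pulled back from pointwise convergence, which can be checked one test
    function at a time. *)
Lemma prob_space_cvg {R : realType} {X : pmetricType R} {I : Type}
    (U : set_system I) (mu_ : I -> prob_space X) (mu : prob_space X) :
  Filter U ->
  (forall f : continuousType X R, integrate (mu_ i) f @[i --> U] --> integrate mu f) ->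
  mu_ i @[i --> U] --> mu.
Proof.
move=> FU mu_mu A.
have /= -> := @nbhsE (initial_topology (@integrate R X)) mu.
move=> [_ [[C oC <-] /= Cmu] CA].
have : (fun i => integrate (mu_ i)) @ U --> (integrate mu : {ptws _ -> _}).
  apply/cvg_sup => f V [_ [[B oB <-] Bf BV]].
  have UB : U [set i | B (integrate (mu_ i) f)].
    exact: mu_mu (open_nbhs_nbhs (conj oB Bf)).
  by apply: (@filterS _ U _ _ _ _ UB) => i; exact: BV.
move=> /(_ C (open_nbhs_nbhs (conj oC Cmu))) UC.
by apply: (@filterS _ U _ _ _ _ UC) => i; exact: CA.
Qed.

Section empirical_limit.
Context {R : realType} {X : pmetricType R} (T : X -> X) {I : Type}
  (U : set_system I) (N : I -> nat) (x : I -> X).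
Hypotheses (cX : compact [set: X]) (UU : UltraFilter U).

Lemma empirical_ultra_cvg : exists mu : prob_space X,
  forall f : continuousType X R,
    integrate (empirical_prob T (N i) (x i)) f @[i --> U] --> integrate mu f.
Proof.
have [g cg] := @cantor_surj R X cX (@metric_hausdorff R X).
have /choice[s gs] : forall y, exists c : cantor_space, g c = y.
  by move=> y; have [c _ <-] := @surj _ _ _ _ g y Logic.I; exists c.
pose k i : R := (N i).-1.+1%:R^-1.
(* The share of the orbit segment whose lifts, through the section [s] of [g], lie in the cylinder
   of [w]. *)
pose m i w : R := k i * \sum_(j < (N i).-1.+1)
  (rprefix (s (iter j T (x i))) (size w) == w)%:R.
have k0 i : 0 < k i by rewrite invr_gt0 ltr0n.
have kN i : k i * (N i).-1.+1%:R = 1 by rewrite mulVf// pnatr_eq0.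
have m01 i w : 0 <= m i w <= 1.
  rewrite mulr_ge0 ?(ltW (k0 i)) ?sumr_ge0//= -(kN i) ler_wpM2l ?(ltW (k0 i))//.
  rewrite -[leRHS]/(_%:R) -[(N i).-1.+1 in leRHS]card_ord -sum1_card natr_sum.
  by apply: ler_sum => j _; case: eqP.
have m_cvg w : cvg (m i w @[i --> U]).
  by apply: (ultra_bounded_cvg U (m^~ w)) (m01^~ w).
pose nu w := lim (m i w @[i --> U]).
have nu0 w : 0 <= nu w.
  by apply: limr_ge => //; apply: nearW => i; have /andP[] := m01 i w.
have nu1 : nu [::] = 1.
  apply/cvg_lim => //; rewrite (_ : m^~ [::] = cst 1); first exact: cvg_cst.
  by apply/funext => i; rewrite /m/= sumr_const card_ord kN.
have nuS w : nu w = nu (false :: w) + nu (true :: w).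
  apply/cvg_lim => //.
  rewrite (_ : m^~ w = (fun i => m i (false :: w) + m i (true :: w))).
    exact: cvgD.
  apply/funext => i; rewrite /m -mulrDr -big_split/=; congr (_ * _).
  by apply: eq_bigr => j _ /=; rewrite !eqseq_cons; case: (s _ _); case: eqP;
    rewrite ?addr0 ?add0r.
have [mu Hmu] := law_of_masses nu g nu0 nu1 nuS cg.
exists (mu : prob_space X) => f.
have cf : continuous f by exact: cts_fun.
apply/cvgrPdist_le => e e0; have e30 : 0 < e / 3 by rewrite divr_gt0.
have cfg : continuous (f \o g).
  by move=> c; apply: continuous_comp; [exact: cg|exact: cf].
(* One length [n] serves both approximations: of [mu] by the [nu]-weighted sum, and of [f \o g] by
   its samples. With [n] fixed, only finitely many masses [m i w] have to converge, and three errors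
   of [e / 3] add up. *)
have [n [/= Hn unif]] := filter_ex (filterI (Hmu f cf _ e30)
  (cantor_unif_continuous (f \o g) _ cfg e30)).
pose a w : R := f (g (extend w)).
have m_sum : \sum_(w : n.-tuple bool) m i w * a w @[i --> U] -->
    \sum_(w : n.-tuple bool) nu w * a w.
  apply: cvg_big => [|w _]; first exact: add_continuous.
  by apply: cvgMr_tmp; exact: m_cvg.
move/cvgrPdist_le : m_sum => /(_ _ e30); apply: filterS => i mi.
have m_emp : `|\sum_(w : n.-tuple bool) m i w * a w -
    integrate (empirical_prob T (N i) (x i)) f| <= e / 3.
  rewrite /integrate integral_empirical//.
  (* Ungrouping the cylinders gives back an orbit average, now of sampled values. *)
  rewrite (_ : \sum_(w : n.-tuple bool) _ = k i * \sum_(j < (N i).-1.+1)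
      a (rprefix (s (iter j T (x i))) n)); last first.
    under eq_bigr do rewrite /m size_tuple -mulrA mulr_suml.
    rewrite -mulr_sumr exchange_big/=; congr (_ * _); apply: eq_bigr => j _.
    rewrite -[RHS](@sum_tuple_eq _ n) ?size_rprefix//.
    by apply: eq_bigr => w _; rewrite mulrC.
  rewrite -mulrBr -sumrB normrM ger0_norm ?(ltW (k0 i))//.
  apply: (@le_trans _ _ (k i * \sum_(j < (N i).-1.+1) (e / 3))).
    rewrite ler_wpM2l ?(ltW (k0 i))// (le_trans (ler_norm_sum _ _ _))//.
    apply: ler_sum => j _; rewrite -[in f (iter _ _ _)](gs (iter j T (x i))).
    by apply: unif; exact: extend_rprefix.
  by rewrite sumr_const card_ord -[X in _ * X]mulr_natr mulrCA kN mulr1.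
rewrite (le_trans (ler_distD (\sum_(w : n.-tuple bool) nu w * a w) _ _))//.
have -> : e = e / 3 + (e / 3 + e / 3) by field.
rewrite lerD//.
by rewrite (le_trans (ler_distD (\sum_(w : n.-tuple bool) m i w * a w) _ _))// lerD.
Qed.

End empirical_limit.

(** The local hypothesis treats nearby points and small scales jointly, which is what near-covering
    compactness along [0^'+] asks for. *)
Lemma compact_uniform {R : realType} {X : pmetricType R} (P : R -> X -> Prop) :
  compact [set: X] ->
  (forall x, exists2 d : R, 0 < d &
     forall x' e, mdist x x' < d -> 0 < e < d -> P e x') ->
  exists2 e : R, 0 < e & forall x, P e x.
Proof.
move=> /compact_near_coveringP cX xP.
have := cX R (0^'+) P _ _.
move=> /(_ _ _)[x _|e /= e0 H].
  have [d d0 dP] := xP x.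
  exists ([set x' | mdist x x' < d], [set e : R | 0 < e < d]); last first.
    by move=> [x' e] /= [xx' ed]; exact: dP.
  split=> /=.
    by have := nbhsx_ballx x _ d0; rewrite ballEmdist.
  exists d => //= e; rewrite /ball_/= sub0r normrN => ed e0.
  by rewrite e0 -(gtr0_norm e0).
exists (e / 2); first by rewrite divr_gt0.
move=> x; apply: H => //; last by rewrite divr_gt0.
by rewrite /= sub0r normrN gtr0_norm ?divr_gt0// gtr_pMr// invf_lt1// ltr1n.
Qed.

(** Heine-Cantor; halving the local radius leaves room for moving from [x] to [x']. *)
Lemma continuous_compact_unif {R : realType} {X : pmetricType R} (f : X -> R)
    (e : R) : compact [set: X] -> continuous f -> 0 < e ->
  exists2 d : R, 0 < d & forall x y, mdist x y < d -> `|f x - f y| <= e.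
Proof.
move=> cX cf e0.
apply: (compact_uniform
  (fun d x => forall y, mdist x y < d -> `|f x - f y| <= e)) => // x.
have /cvgrPdist_le /(_ (e / 2)) := cf x; rewrite divr_gt0// => /(_ isT).
rewrite -nbhs_ballE => -[d /= d0]; rewrite ballEmdist => fd.
exists (d / 2); first by rewrite divr_gt0.
move=> x' r xx' /andP[r0 rd] y x'y.
have d2d : d / 2 <= d by lra.
rewrite (le_trans (ler_distD (f x) _ _))// (splitr e) lerD//.
  by rewrite distrC; apply: fd => /=; rewrite (lt_le_trans xx').
apply: fd => /=; rewrite (le_lt_trans (metric_triangle _ x' _))// (splitr d).
by rewrite ltrD// (lt_trans x'y).
Qed.

(** Counterexamples at the scales [k.+1%:R^-1] would have empirical measures with a common limit
    [mu] along an ultrafilter, and continuity of [E] at [mu] brings their energies within two thirds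
    of [eta]. The lengths need not tend to infinity, so one [eps] serves all [n]. At [n = 0] the
    Bowen ball is all of [X] while the empirical measure is a Dirac mass, whence [0 < n]. *)
Lemma energy_bowen_unif {R : realType} {X : pmetricType R} (T : X -> X)
    (E : prob_space X -> R) (eta : R) :
  compact [set: X] -> continuous E -> 0 < eta ->
  exists2 eps : R, 0 < eps & forall n x y, (0 < n)%N -> bowen_ball T n eps x y ->
    `|E (empirical_prob T n x) - E (empirical_prob T n y)| <= eta.
Proof.
move=> cX cE eta0; apply: contrapT => noeps.
have /choice[u Hu] : forall k : nat, exists u : nat * (X * X),
    [/\ (0 < u.1)%N, bowen_ball T u.1 k.+1%:R^-1 u.2.1 u.2.2 &
    eta < `|E (empirical_prob T u.1 u.2.1) - E (empirical_prob T u.1 u.2.2)|].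
  move=> k; apply: contrapT => nok; apply: noeps.
  exists k.+1%:R^-1 => [|n x y n0 xy]; first by rewrite invr_gt0 ltr0n.
  by rewrite leNgt; apply/negP => H; apply: nok; exists (n, (x, y)).
have [U [UU ooU]] := ultraFilterLemma eventually_filter.
have [mu mux] := empirical_ultra_cvg T U (fun k => (u k).1) (fun k => (u k).2.1) cX UU.
(* Both orbits stay closer than the modulus of continuity of [f] once [k] is large, so the second
   family has the limit of the first. *)
have muy (f : continuousType X R) :
    integrate (empirical_prob T (u k).1 (u k).2.2) f @[k --> U] --> integrate mu f.
  have cf : continuous f by exact: cts_fun.
  apply/cvgrPdist_le => e e0; have e20 : 0 < e / 2 by rewrite divr_gt0.
  have [d d0 fd] := continuous_compact_unif f _ cX cf e20.
  have Ud : U [set k : nat | k.+1%:R^-1 < d].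
    by apply: ooU; apply: near_infty_natSinv_lt (PosNum d0).
  have /cvgrPdist_le /(_ _ e20) := mux f; move: Ud.
  apply: (@filterS2 _ U) => k /= kd muk; rewrite (splitr e).
  rewrite (le_trans (ler_distD (integrate (empirical_prob T (u k).1 (u k).2.1) f) _ _))//.
  rewrite lerD//; have [n0 xy _] := Hu k.
  rewrite /integrate !integral_empirical// -mulrBr -sumrB.
  rewrite normrM ger0_norm ?invr_ge0 ?ler0n// mulrC ler_pdivrMr ?ltr0n//.
  rewrite (le_trans (ler_norm_sum _ _ _))//.
  rewrite -[X in _ * X%:R]card_ord mulr_natr -sumr_const; apply: ler_sum => j _.
  apply: fd; rewrite (lt_trans _ kd)//; apply: xy.
  (* The average runs over [n.-1.+1] points, which is [n] for a positive length. *)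
  by rewrite -[X in (_ < X)%N](prednK n0).
have Emu (v : nat -> prob_space X) : (forall f : continuousType X R,
    integrate (v k) f @[k --> U] --> integrate mu f) -> E (v k) @[k --> U] --> E mu.
  by move=> vmu; apply: continuous_cvg; [exact: cE|exact: prob_space_cvg].
have e20 : 0 < eta / 3 by rewrite divr_gt0.
have /cvgrPdist_le /(_ _ e20) Ex := Emu _ mux.
have /cvgrPdist_le /(_ _ e20) Ey := Emu _ muy.
have [k [/= kx ky]] := filter_ex (filterI Ex Ey).
have [_ _] := Hu k; apply/negP; rewrite -leNgt.
rewrite (le_trans (ler_distD (E mu) _ _))// distrC.
rewrite (le_trans (lerD kx ky))// -mulrDl ler_pdivrMr// ; lra.
Qed.

(** * Covers and iterated joins *)

Lemma le_esum_inj {R : realType} {I J : choiceType} (A : set I) (B : set J)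
    (h : I -> J) (f : I -> \bar R) (g : J -> \bar R) :
  set_inj A h -> (forall i, A i -> B (h i)) ->
  (forall i, A i -> (f i <= g (h i))%E) ->
  (\esum_(i in A) f i <= \esum_(j in B) g j)%E.
Proof.
move=> hinj hB fg; rewrite (le_trans (le_esum fg))//.
rewrite -(esum_image A h g)//; apply: ereal_sup_le.
move=> _ [F [finF FA] <-]; exists F => //; split=> // j /FA[i Ai <-].
exact: hB.
Qed.


(** Choosing one preimage of each image point injects the image into [A]; [i0] is the default
    elsewhere. *)
Lemma le_esum_image {R : realType} {I J : choiceType} (A : set I) (h : I -> J)
    (f : J -> \bar R) (g : I -> \bar R) :
  (forall i, A i -> (f (h i) <= g i)%E) ->
  (\esum_(j in h @` A) f j <= \esum_(i in A) g i)%E.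
Proof.
move=> fg.
have [A0|/set0P[i0 Ai0]] := eqVneq A set0.
  by rewrite A0 image_set0 !esum_set0.
have /choice[k kP] : forall j, exists i, (h @` A) j -> A i /\ h i = j.
  move=> j; have [[i Ai ij]|nj] := pselect ((h @` A) j); first by exists i.
  by exists i0.
apply: (le_esum_inj (h @` A) A k).
- move=> j j' /set_mem/kP[_ hj] /set_mem/kP[_ hj'] kjj'.
  by rewrite -hj -hj' kjj'.
- by move=> j /kP[].
- by move=> j /kP[Ak hk]; rewrite -[in leLHS]hk; exact: fg.
Qed.

Lemma fsum_esum {R : realType} {I : choiceType} (A : set I) (f : I -> \bar R) :
  finite_set A -> (forall i, (0 <= f i)%E) ->
  (\sum_(i \in A) f i = \esum_(i in A) f i)%E.
Proof. by move=> finA f0; rewrite esum_fset. Qed.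

Section iter_join.
Context {R : realType} {X : pmetricType R} (T : X -> X).
Implicit Types U V : set (set X).

(** The family [f] is arbitrary because the induction peels off the first index and shifts the
    others. *)
Lemma big_joinP (f : nat -> X -> X) U n B :
  (\big[join/[set [set: X]]]_(i < n) [set f i @^-1` A | A in U]) B <->
  exists a : nat -> set X, (forall i, (i < n)%N -> U (a i)) /\
  B = [set x | forall i, (i < n)%N -> a i (f i x)].
Proof.
elim: n f B => [|n IH] f B.
  rewrite big_ord0; split=> [->|[a [_ ->]]].
    by exists (fun=> set0); split=> //; apply/seteqP; split.
  by apply/seteqP; split.
rewrite big_ord_recl.
split=> [[_ [A UA <-] [C /(IH (fun i => f i.+1))[a [Ua ->]] <-]]|[a [Ua ->]]].
  exists (fun i => if i is j.+1 then a j else A); split=> [[//|i] /Ua//|].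
  apply/seteqP; split=> [x [Ax ax] [//|i] /ax//|x ax] /=.
  by split=> [|i iltn]; [exact: (ax 0%N)|exact: (ax i.+1)].
exists (f 0%N @^-1` a 0%N); first by exists (a 0%N) => //; exact: Ua.
exists [set x | forall i, (i < n)%N -> a i.+1 (f i.+1 x)].
  apply/(IH (fun i => f i.+1)); exists (fun i => a i.+1); split=> // i iltn.
  exact: Ua.
apply/seteqP; split=> [x [a0x ax] [//|i] /ax//|x ax].
by split=> [|i iltn]; exact: ax.
Qed.

Lemma iter_joinP U n B : iter_join T U n B <-> exists a : nat -> set X,
  (forall i, (i < n)%N -> U (a i)) /\
  B = [set x | forall i, (i < n)%N -> a i (iter i T x)].
Proof. exact: (big_joinP (fun i => iter i T)). Qed.

Lemma finite_iter_join U n : finite_set U -> finite_set (iter_join T U n).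
Proof.
move=> finU; rewrite /iter_join; elim/big_rec: _ => [|i V _ finV].
  exact: finite_set1.
by apply: finite_image2 finV; exact: finite_image.
Qed.

Lemma open_iter_join U n B : continuous T -> (forall A, U A -> open A) ->
  iter_join T U n B -> open B.
Proof.
move=> cT oU; rewrite /iter_join; elim/big_rec: _ B => [B ->|i V _ oV B].
  exact: openT.
move=> [_ [A /oU oA <-] [C /oV oC <-]]; apply: openI => //.
apply: open_comp => // x _; elim: (i : nat) x => [|k cTk] x; first exact: cvg_id.
exact: (continuous_comp (cTk x) (cT _)).
Qed.

Lemma refines_iter_join U V n : refines V U ->
  refines (iter_join T V n) (iter_join T U n).
Proof.
move=> VU _ /iter_joinP[a [Va ->]].
have /choice[b ab] i : exists B, (i < n)%N -> U B /\ a i `<=` B.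
  by have [/Va/VU[B UB aB]|] := boolP (i < n)%N; [exists B|exists set0].
exists [set x | forall i, (i < n)%N -> b i (iter i T x)].
  by apply/iter_joinP; exists b; split=> // i /ab[].
by move=> x ax i iltn; have [_] := ab i iltn; apply; exact: ax.
Qed.

End iter_join.

(** * Diameters and Lebesgue numbers *)

Section diameter.
Context {R : realType} {X : pmetricType R}.
Hypothesis cX : compact [set: X].

Lemma compact_mdist_bounded : exists M : R, forall x y : X, mdist x y <= M.
Proof.
(* The bound is encoded as the inverse of a scale, so that shrinking the scale weakens the claim and
   [compact_uniform] applies. *)
have [e e0 He] : exists2 e : R, 0 < e & forall x : X, mdist point x <= e^-1.
  apply: (compact_uniform (fun e x => mdist point x <= e^-1)) => // x.
  have x1 : 0 < mdist point x + 1 by rewrite ltr_wpDl// mdist_ge0.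
  exists (mdist point x + 1)^-1; first by rewrite invr_gt0.
  move=> x' e xx' /andP[e0 ex].
  rewrite (le_trans (metric_triangle _ x _))//.
  have x'1 : mdist x x' <= 1.
    by rewrite (le_trans (ltW xx'))// invf_le1// lerDr mdist_ge0.
  rewrite (le_trans (lerD (lexx _) x'1))// -[leLHS]invrK.
  by rewrite lef_pV2 ?posrE ?invr_gt0// ltW.
exists (e^-1 + e^-1) => x y.
by rewrite (le_trans (metric_triangle _ point _))// lerD// metric_sym.
Qed.

Lemma mdist_le_diam (A : set X) x y : A x -> A y -> mdist x y <= diam A.
Proof.
move=> Ax Ay; have [M HM] := compact_mdist_bounded.
apply: ub_le_sup; first by exists M => _ [a _ [b _ <-]].
by exists x => //; exists y.
Qed.

Lemma mdist_le_cover_diam (U : set (set X)) (A : set X) x y : finite_set U ->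
  U A -> A x -> A y -> mdist x y <= cover_diam U.
Proof.
move=> finU UA Ax Ay; rewrite (le_trans (mdist_le_diam A x y Ax Ay))//.
apply: ub_le_sup; last by exists A.
have [M HM] := compact_mdist_bounded; exists M => _ [B _ <-].
(* An empty element has diameter 0 by the convention on [sup], and [M] is nonnegative since it
   bounds a distance. *)
have [->|/set0P[b Bb]] := eqVneq B set0.
  rewrite /diam (_ : [set _ | _ in _ & _ in _] = set0) ?sup0.
    by rewrite (le_trans (mdist_ge0 x y)).
  by apply/seteqP; split=> // r [].
apply: ge_sup; first by exists (mdist b b); exists b => //; exists b.
by move=> _ [u _ [v _ <-]].
Qed.

Lemma lebesgue_number (U : set (set X)) : is_open_cover U ->
  exists2 eps : R, 0 < eps &
    forall x, exists2 A, U A & [set y | mdist x y < eps] `<=` A.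
Proof.
move=> [[_ _ UT] oU].
apply: (compact_uniform (fun eps x =>
  exists2 A, U A & [set y | mdist x y < eps] `<=` A)) => // x.
have [A UA Ax] : (\bigcup_(A in U) A) x by rewrite UT.
have : nbhs x A by apply: open_nbhs_nbhs; split=> //; exact: oU.
rewrite -nbhs_ballE => -[d /= d0]; rewrite ballEmdist => dA.
exists (d / 2); first by rewrite divr_gt0.
move=> x' e xx' /andP[e0 ed]; exists A => // y /= x'y; apply: dA => /=.
rewrite (le_lt_trans (metric_triangle _ x' _))// (splitr d) ltrD//.
by rewrite (lt_trans x'y).
Qed.

Lemma exists_small_open_cover (delta : R) : 0 < delta ->
  exists2 U : set (set X), is_open_cover U & cover_diam U <= delta.
Proof.
move=> d0; pose r := delta / 2; have r0 : 0 < r by rewrite divr_gt0.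
pose f (x : X) := (ball x r)°.
have : cover_compact [set: X] by rewrite -compact_cover.
move=> /(_ X setT f _ _)[x _|x _|D _ DT].
- exact: open_interior.
- by exists x => //; exact: nbhsx_ballx.
have oU A : (f @` [set` D]) A -> open A by move=> [x _ <-]; exact: open_interior.
exists (f @` [set` D]).
  split=> //; split; first exact: finite_image.
    by move=> A /oU; exact: sub_sigma_algebra.
  apply/seteqP; split=> // x _; have [//|y Dy fyx] := DT x.
  by exists (f y) => //; exists y.
have diam_f x : diam (f x) <= delta.
  apply: ge_sup.
    have fx : f x x by exact: nbhsx_ballx.
    by exists (mdist x x); exists x => //; exists x.
  move=> _ [u /interior_subset + [v /interior_subset + <-]].
  rewrite ballEmdist /= => xu xv; rewrite (le_trans (metric_triangle _ x _))//.
  by rewrite (splitr delta) lerD// ?[mdist u _]metric_sym ltW.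
(* Bounding a supremum from above by [ge_sup] takes a nonempty set: some member of the cover
   contains [point]. *)
have [//|y Dy _] := DT point.
apply: ge_sup; first by exists (diam (f y)); exists (f y) => //; exists y.
by move=> _ [_ [x _ <-] <-].
Qed.

Lemma refines_small (U V : set (set X)) (eps : R) : finite_set V ->
  (forall x, exists2 A, U A & [set y | mdist x y < eps] `<=` A) ->
  cover_diam V < eps -> refines V U.
Proof.
move=> finV Ueps Veps A VA; have [->|/set0P[a Aa]] := eqVneq A set0.
  by have [B UB _] := Ueps point; exists B.
have [B UB aB] := Ueps a; exists B => // y Ay; apply: aB => /=.
by rewrite (le_lt_trans _ Veps)// (mdist_le_cover_diam V A).
Qed.

End diameter.

(** * Inequalities between the partition sums at a fixed time *)

Section comparison.
Context {R : realType} {X : pmetricType R} (T : X -> X) (E : prob_space X -> R).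
Implicit Types U V : set (set X).

Local Open Scope ereal_scope.

Lemma weight_ge0 n x : 0 <= weight T E n x.
Proof. by rewrite lee_fin expR_ge0. Qed.

Lemma inf_weight_ge0 n A : 0 <= inf_weight T E n A.
Proof. by apply: le_ereal_inf_tmp => _ [x _ <-]; exact: weight_ge0. Qed.

Lemma sup_weight_ge0 n A : 0 <= sup_weight T E n A.
Proof. by rewrite /sup_weight le_max lexx. Qed.

Lemma inf_weight_le n A x : A x -> inf_weight T E n A <= weight T E n x.
Proof. by move=> Ax; apply: ereal_inf_lbound; exists x. Qed.

Lemma le_sup_weight n A x : A x -> weight T E n x <= sup_weight T E n A.
Proof.
move=> Ax; rewrite /sup_weight le_max; apply/orP; right.
by apply: ereal_sup_ubound; exists x.
Qed.

Lemma Psep_ge0 eps n : 0 <= Psep T E eps n.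
Proof.
apply: ereal_sup_ubound; exists set0; last by rewrite esum_set0.
by move=> x y [].
Qed.

Lemma Qspan_ge0 eps n : 0 <= Qspan T E eps n.
Proof.
apply: le_ereal_inf_tmp => _ [F _ <-]; apply: esum_ge0 => x _.
exact: weight_ge0.
Qed.

Lemma pcover_ge0 i U n : 0 <= pcover T E i U n.
Proof.
by case: i => /=; apply: le_ereal_inf_tmp => _ [V _ <-];
  apply: fsume_ge0 => A _; (exact: sup_weight_ge0 || exact: inf_weight_ge0).
Qed.

Lemma le_Psep (eps eps' : R) n : (eps <= eps')%R ->
  Psep T E eps' n <= Psep T E eps n.
Proof.
move=> ee'; apply: ereal_sup_le => _ [A sepA <-]; exists A => //.
move=> x y Ax Ay xy Bxy; apply: (sepA x y Ax Ay xy) => i /Bxy xyi.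
exact: lt_le_trans ee'.
Qed.

Lemma le_Qspan (eps eps' : R) n : (eps <= eps')%R ->
  Qspan T E eps' n <= Qspan T E eps n.
Proof.
move=> ee'; apply: ereal_inf_le_tmp => _ [F spanF <-]; exists F => //.
move=> x; have [y Fy Bxy] := spanF x; exists y => // i /Bxy xyi.
exact: lt_le_trans ee'.
Qed.

Lemma Qspan_le_Psep (eps : R) n : (0 < eps)%R -> Qspan T E eps n <= Psep T E eps n.
Proof.
(* Zorn's lemma applies since two points of the union of a chain lie in a common member. *)
move=> e0; have [F FP Ftot|A [sepA maxA]] :=
    @Zorn_bigcup X (fun A => separated T n eps A).
  move=> x y [A FA Ax] [B FB By].
  have [AB|BA] := Ftot A B FA FB; first exact: FP FB _ _ (AB x Ax) By.
  exact: FP FA _ _ Ax (BA y By).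
apply: (@le_trans _ _ (\esum_(x in A) weight T E n x)); last first.
  by apply: ereal_sup_ubound; exists A.
apply: ereal_inf_lbound; exists A => // x; apply: contrapT => nx.
have Ax : ~ A x.
  by move=> Ax; apply: nx; exists x => // i _; rewrite mdistxx.
(* A point [x] in reach of no point of [A] could be added to [A], against maximality. *)
apply: (maxA (A `|` [set x])).
  split; first by move=> y Ay; left.
  by move=> AxA; apply: Ax; apply: AxA; right.
move=> y z [Ay|->] [Az|->] yz Byz //.
- exact: (sepA y z).
- by apply: nx; exists y => // i /Byz; rewrite metric_sym.
- by apply: nx; exists z.
Qed.

Lemma subcover_is_cover U n beta : continuous T -> is_open_cover U ->
  finite_set beta -> is_subcover (iter_join T U n) beta ->
  is_cover beta /\ refines beta (iter_join T U n).
Proof.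
move=> cT [_ oU] finb [bU bT]; split=> [|A bA]; last by exists A => //; exact: bU.
split=> // A /bU/(open_iter_join T U n A cT oU); exact: sub_sigma_algebra.
Qed.

Lemma p1_le_p3 U n : continuous T -> is_open_cover U ->
  p1 T E U n <= p3 T E U n.
Proof.
move=> cT oU; apply: ereal_inf_le_tmp => _ [b [finb bU] <-].
by exists b => //; exact: subcover_is_cover.
Qed.

Lemma p2_le_p4 U n : continuous T -> is_open_cover U ->
  p2 T E U n <= p4 T E U n.
Proof.
move=> cT oU; apply: ereal_inf_le_tmp => _ [b [finb bU] <-].
by exists b => //; exact: subcover_is_cover.
Qed.

Lemma refines_trans U V W : refines U V -> refines V W -> refines U W.
Proof.
move=> UV VW A /UV[B /VW[C WC BC] AB]; exists C => //.
exact: subset_trans BC.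
Qed.

(** Every cover competing for the finer [V] also competes for [U]. *)
Lemma le_p1 U V n : refines V U -> p1 T E U n <= p1 T E V n.
Proof.
move=> VU; apply: ereal_inf_le_tmp => _ [b [covb bV] <-]; exists b => //.
by split=> //; apply: refines_trans bV _; exact: refines_iter_join.
Qed.

Lemma iter_join_bowen U n (eps : R) B x y : compact [set: X] -> finite_set U ->
  (cover_diam U < eps)%R -> iter_join T U n B -> B x -> B y ->
  bowen_ball T n eps x y.
Proof.
move=> cX finU Ueps /iter_joinP[a [Ua ->]] ax ay i iltn.
rewrite (le_lt_trans _ Ueps)//.
by apply: (mdist_le_cover_diam cX U (a i)) => //; [exact: Ua|exact: ax|exact: ay].
Qed.

Lemma Psep_le_p1 U n (eps : R) : compact [set: X] -> finite_set U ->
  (cover_diam U < eps)%R -> Psep T E eps n <= p1 T E U n.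
Proof.
move=> cX finU Ueps; apply: ge_ereal_sup => _ [A sepA <-].
apply: le_ereal_inf_tmp => _ [V [[finV _ VT] VU] <-].
(* [h] is injective on [A]: two points sent to the same element of [V] share an element of the join,
   hence are Bowen-close. *)
have /choice[h hV] : forall x, exists B, V B /\ B x.
  move=> x; have [B VB Bx] : (\bigcup_(B in V) B) x by rewrite VT.
  by exists B.
rewrite fsum_esum//; last by move=> B; exact: sup_weight_ge0.
apply: (le_esum_inj A V h).
- move=> x y /set_mem Ax /set_mem Ay hxy; apply: contrapT => xy.
  have [Vx hx] := hV x; have [_ hy] := hV y.
  have [C UC hC] := VU _ Vx; apply: (sepA x y Ax Ay xy).
  apply: (iter_join_bowen U n eps C) => //; apply: hC => //.
  by rewrite hxy.
- by move=> x _; have [] := hV x.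
- by move=> x _; apply: le_sup_weight; have [] := hV x.
Qed.

(** Following the orbit of [x] with elements of [U] that contain the [eps]-balls gives an element
    [h x] of the join around the Bowen ball. These form a subcover as [x] runs over a spanning set,
    finite because the join is. *)
Lemma p4_le_Qspan U n (eps : R) : (0 < eps)%R -> finite_set U ->
  (forall x, exists2 A, U A & [set y | mdist x y < eps]%R `<=` A) ->
  p4 T E U n <= Qspan T E eps n.
Proof.
move=> e0 finU Ueps; apply: le_ereal_inf_tmp => _ [F spanF <-].
have /choice[a aU] : forall x, exists A, U A /\ [set y | mdist x y < eps]%R `<=` A.
  by move=> x; have [A UA xA] := Ueps x; exists A.
pose h x := [set y | forall i, (i < n)%N -> a (iter i T x) (iter i T y)].
have hU x : iter_join T U n (h x).
  apply/iter_joinP; exists (fun i => a (iter i T x)); split=> // i _.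
  by have [] := aU (iter i T x).
have ball_h x : bowen_ball T n eps x `<=` h x.
  by move=> y xy i iltn; have [_] := aU (iter i T x); apply; exact: xy.
have finh : finite_set (h @` F).
  apply: sub_finite_set (finite_iter_join T U n finU) => _ [x _ <-].
  exact: hU.
apply: (@le_trans _ _ (\esum_(B in h @` F) inf_weight T E n B)).
  rewrite -fsum_esum//; last by move=> B; exact: inf_weight_ge0.
  apply: ereal_inf_lbound; exists (h @` F) => //; split=> //.
  split=> [_ [x _ <-]//|]; apply/seteqP; split=> // x _.
  have [y Fy xy] := spanF x; exists (h y); first by exists y.
  by apply: ball_h => i /xy; rewrite metric_sym.
apply: le_esum_image => x _; apply: inf_weight_le; apply: ball_h => i _.
by rewrite mdistxx.
Qed.

(** Each [A] in [V] is enlarged to an element [h A] of the join. All of [h A] is Bowen-close to any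
    point of [A], so passing from the infimum over [A] to the supremum over [h A] costs at most the
    exponential factor. *)
Lemma p3_le_p2 U n (eps eta : R) : compact [set: X] -> finite_set U ->
  (cover_diam U < eps)%R ->
  (forall x y, bowen_ball T n eps x y ->
    `|E (empirical_prob T n x) - E (empirical_prob T n y)| <= eta)%R ->
  p3 T E U n <= (expR (n%:R * eta))%:E * p2 T E U n.
Proof.
move=> cX finU Ueps unif; have c0 := expR_gt0 (n%:R * eta)%R.
rewrite -lee_pdivrMl//; apply: le_ereal_inf_tmp => _ [V [[finV _ VT] VU] <-].
rewrite lee_pdivrMl//.
have /choice[h hU] : forall A, exists B, V A -> iter_join T U n B /\ A `<=` B.
  move=> A; have [/VU[B UB AB]|nVA] := pselect (V A); first by exists B.
  by exists set0.
have finh : finite_set (h @` V) by exact: finite_image.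
apply: (@le_trans _ _ (\esum_(B in h @` V) sup_weight T E n B)).
  rewrite -fsum_esum//; last by move=> B; exact: sup_weight_ge0.
  apply: ereal_inf_lbound; exists (h @` V) => //; split=> //.
  split=> [_ [A /hU[UhA _] <-]//|]; apply/seteqP; split=> // x _.
  have [A VA Ax] : (\bigcup_(A in V) A) x by rewrite VT.
  by exists (h A); [exists A|have [_] := hU A VA; exact].
rewrite ge0_mule_fsumr; last by move=> A; exact: inf_weight_ge0.
rewrite fsum_esum//; last first.
  by move=> A; apply: mule_ge0; [rewrite lee_fin ltW|exact: inf_weight_ge0].
apply: le_esum_image => A /hU[UhA AhA].
(* For empty [A] the infimum is [+oo] and the bound is void. *)
rewrite -lee_pdivrMl//; apply: le_ereal_inf_tmp => _ [x Ax <-].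
rewrite lee_pdivrMl// /sup_weight ge_max; apply/andP; split.
  by apply: mule_ge0; [rewrite lee_fin ltW|exact: weight_ge0].
apply: ge_ereal_sup => _ [y hAy <-].
rewrite /weight -EFinM -expRD lee_fin ler_expR -mulrDr ler_wpM2l ?ler0n//.
rewrite -lerBlDr (le_trans (ler_norm _))//; apply: unif.
exact: (iter_join_bowen U n eps (h A) y x cX finU Ueps UhA hAy (AhA x Ax)).
Qed.

End comparison.

(** * Exponential rates and limits *)

Section rates.
Context {R : realType}.
Local Open Scope ereal_scope.

Lemma le_limn_einf (u v : nat -> \bar R) :
  (forall n, u n <= v n) -> limn_einf u <= limn_einf v.
Proof.
move=> uv; rewrite !limn_einf_lim.
apply: lee_lim; [exact: is_cvg_einfs|exact: is_cvg_einfs|].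
apply: nearW => n; apply: le_ereal_inf_tmp => _ [m nm <-].
by rewrite (le_trans _ (uv m))//; apply: ereal_inf_lbound; exists m.
Qed.

(** After taking logarithms and dividing by [n], the factor contributes exactly [eta]. *)
Lemma lower_rate_le (u v : nat -> \bar R) (eta : R) : (0 <= eta)%R ->
  (forall n, 0 <= u n) -> (forall n, 0 <= v n) ->
  (forall n, (0 < n)%N -> u n <= (expR (n%:R * eta))%:E * v n) ->
  lower_rate u <= eta%:E + lower_rate v.
Proof.
move=> eta0 u0 v0 uv; rewrite /lower_rate -limn_einf_shift//.
(* At index 0 the inverse is 0 by convention, and the claim reduces to [0 <= eta]. *)
apply: le_limn_einf => -[|n]; first by rewrite invr0 !mul0e adde0 lee_fin.
have c0 := expR_gt0 (n.+1%:R * eta)%R.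
have n0 : (0 < n.+1%:R^-1 :> R)%R by rewrite invr_gt0.
(* A vanishing [v] forces [u] to vanish, and both logarithms are [-oo]. *)
have [v00|vn0] := eqVneq (v n.+1) 0.
  have -> : u n.+1 = 0.
    apply/eqP; rewrite eq_le u0 andbT (le_trans (uv _ _))//.
    by rewrite v00 mule0.
  by rewrite v00 /= lexx mulr_infty gtr0_sg// mul1e addeNy.
have v0' : 0 < v n.+1 by rewrite lt_neqAle eq_sym vn0 v0.
apply: (@le_trans _ _ (n.+1%:R^-1%:E * lne ((expR (n.+1%:R * eta))%:E * v n.+1))).
  rewrite lee_pmul2l ?lte_fin//.
  rewrite lee_lne ?uv// in_itv/= leey andbT//.
  by apply: mule_ge0; rewrite // lee_fin ltW.
rewrite lneM ?in_itv/= ?leey ?lte_fin ?c0 ?v0'//.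
rewrite (leNgt (expR _)) c0/= expRK muleDr// -EFinM mulrA mulVf ?pnatr_eq0// mul1r.
by [].
Qed.

Lemma le_lower_rate (u v : nat -> \bar R) :
  (forall n, 0 <= u n) -> (forall n, 0 <= v n) ->
  (forall n, (0 < n)%N -> u n <= v n) -> lower_rate u <= lower_rate v.
Proof.
move=> u0 v0 uv; rewrite -[leRHS]add0e.
apply: lower_rate_le => // n n0.
by rewrite mulr0 expR0 mul1e; exact: uv.
Qed.

Lemma cvg_at_right0_sup (f : R -> \bar R) :
  (forall x y : R, (0 < x)%R -> (x <= y)%R -> f y <= f x) ->
  lim (f x @[x --> 0^'+]) = ereal_sup [set f x | x in [set x | (0 < x)%R]].
Proof.
move=> nif; apply/cvg_lim => //.
have -> : [set f x | x in [set x | (0 < x)%R]] = f @` [set` `]0%R, +oo[%O].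
  by congr (_ @` _); apply/seteqP; split=> x /=; rewrite in_itv/= andbT.
apply: nonincreasing_at_right_cvge => // x y; rewrite !in_itv/= !andbT.
by move=> x0 y0 xy; exact: nif.
Qed.

(** Applied with [S] the set of rates of [Psep], whose supremum is [lower_P]. As that supremum may
    be infinite, closeness is expressed by one-sided bounds that make sense in the extended
    reals. *)
Lemma cvge_sup_squeeze {I : Type} (F : set_system I) (g : I -> \bar R)
    (S : set (\bar R)) : Filter F ->
  (forall e : R, (0 < e)%R -> \forall x \near F, g x <= ereal_sup S + e%:E) ->
  (forall s, S s -> forall e : R, (0 < e)%R -> \forall x \near F, s <= e%:E + g x) ->
  g x @[x --> F] --> ereal_sup S.
Proof.
move=> FF gS Sg; case lS : (ereal_sup S) gS => [r| |] gS.
- have lower e : (0 < e)%R -> \forall x \near F, r%:E - e%:E <= g x.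
    move=> e0; have e20 : (0 < e / 2)%R by rewrite divr_gt0.
    have [|s Ss] := @ub_ereal_sup_adherent R S (e / 2) e20; first by rewrite lS.
    rewrite lS => rs; apply: filterS (Sg s Ss _ e20) => x sx.
    have := le_trans (ltW rs) sx.
    by case: (g x) => [y| |]//; rewrite -!EFinB -?EFinD ?lee_fin ?leey//; lra.
  apply/fine_cvgP; split.
    near=> x; have : r%:E - 1%:E <= g x by near: x; exact: lower.
    have : g x <= r%:E + 1%:E by near: x; exact: gS.
    by case: (g x).
  apply/cvgrPdist_le => e e0; near=> x.
  have : r%:E - e%:E <= g x by near: x; exact: lower.
  have : g x <= r%:E + e%:E by near: x; exact: gS.
  rewrite /=; case: (g x) => [y| |]//=; rewrite -EFinB -EFinD !lee_fin => ? ?.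
  by rewrite ler_norml; lra.
- apply/cvgeyPge => A.
  (* The extra 1 pays for the error [e = 1] in the hypothesis on [s]. *)
  have /ereal_sup_gt[s Ss As] : (A + 1)%:E < ereal_sup S by rewrite lS ltry.
  apply: filterS (Sg s Ss 1%R ltr01) => x sx.
  have := le_trans (ltW As) sx.
  by case: (g x) => [y| |]//; rewrite -?EFinD ?lee_fin ?leey//; lra.
- apply/cvgeNyPle => A; apply: filterS (gS 1%R ltr01) => x.
  by rewrite addNye leeNy_eq => /eqP ->; exact: leNye.
Unshelve. all: by end_near. Qed.

End rates.

(** * Comparison of the lower pressures *)

Section pressure_comparison.
Context {R : realType} {X : pmetricType R} (T : X -> X) (E : prob_space X -> R).
Hypotheses (cX : compact [set: X]) (cT : continuous T) (cE : continuous E).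
Implicit Types U : set (set X).

Local Open Scope ereal_scope.

Lemma lower_P_sup : lower_P T E =
  ereal_sup [set lower_rate (Psep T E eps) | eps in [set eps | (0 < eps)%R]].
Proof.
apply: cvg_at_right0_sup => x y x0 xy.
apply: le_lower_rate => n *; [exact: Psep_ge0|exact: Psep_ge0|exact: le_Psep].
Qed.

Lemma lower_Q_sup : lower_Q T E =
  ereal_sup [set lower_rate (Qspan T E eps) | eps in [set eps | (0 < eps)%R]].
Proof.
apply: cvg_at_right0_sup => x y x0 xy.
apply: le_lower_rate => n *; [exact: Qspan_ge0|exact: Qspan_ge0|exact: le_Qspan].
Qed.

Lemma lower_rate_Psep_le (eps : R) : (0 < eps)%R ->
  lower_rate (Psep T E eps) <= lower_P T E.
Proof. by move=> e0; rewrite lower_P_sup; apply: ereal_sup_ubound; exists eps. Qed.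

Lemma lower_Q_le_P : lower_Q T E <= lower_P T E.
Proof.
rewrite lower_Q_sup; apply: ge_ereal_sup => _ [eps /= e0 <-].
apply: (le_trans _ (lower_rate_Psep_le eps e0)).
apply: le_lower_rate => n *; [exact: Qspan_ge0|exact: Psep_ge0|].
exact: Qspan_le_Psep.
Qed.

Lemma lower_P2_le_P4 U : is_open_cover U ->
  lower_Pcover T E v2 U <= lower_Pcover T E v4 U.
Proof.
move=> oU; apply: le_lower_rate => n *;
  [exact: pcover_ge0|exact: pcover_ge0|exact: p2_le_p4].
Qed.

Lemma lower_P4_le_Q U : is_open_cover U -> lower_Pcover T E v4 U <= lower_Q T E.
Proof.
move=> oU; have [eps e0 Ueps] := lebesgue_number cX U oU.
rewrite lower_Q_sup; apply: (@le_trans _ _ (lower_rate (Qspan T E eps))); last first.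
  by apply: ereal_sup_ubound; exists eps.
apply: le_lower_rate => n *; [exact: pcover_ge0|exact: Qspan_ge0|].
by apply: p4_le_Qspan => //; case: oU => -[].
Qed.

Lemma lower_Psep_le_P1 U (eps : R) : is_open_cover U -> (cover_diam U < eps)%R ->
  lower_rate (Psep T E eps) <= lower_Pcover T E v1 U.
Proof.
move=> oU Ueps; apply: le_lower_rate => n *; [exact: Psep_ge0|exact: pcover_ge0|].
by apply: Psep_le_p1 => //; case: oU => -[].
Qed.

Lemma lower_P1_le_P3 U : is_open_cover U ->
  lower_Pcover T E v1 U <= lower_Pcover T E v3 U.
Proof.
move=> oU; apply: le_lower_rate => n *;
  [exact: pcover_ge0|exact: pcover_ge0|exact: p1_le_p3].
Qed.

Lemma lower_P3_le_P2 (eta : R) : (0 < eta)%R ->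
  exists2 eps : R, (0 < eps)%R & forall U, is_open_cover U ->
    (cover_diam U < eps)%R ->
    lower_Pcover T E v3 U <= eta%:E + lower_Pcover T E v2 U.
Proof.
move=> eta0; have [eps e0 unif] := energy_bowen_unif T E eta cX cE eta0.
exists eps => // U [[finU _ _] _] Ueps.
apply: lower_rate_le => [|n|n|n n0].
- exact: ltW.
- exact: pcover_ge0.
- exact: pcover_ge0.
- by apply: (p3_le_p2 T E U n eps eta) => // x y; exact: unif.
Qed.

Lemma lower_P1_refines U V : refines V U ->
  lower_Pcover T E v1 U <= lower_Pcover T E v1 V.
Proof.
move=> VU; apply: le_lower_rate => n *;
  [exact: pcover_ge0|exact: pcover_ge0|exact: le_p1].
Qed.

Lemma lower_Pcover_le (eta : R) : (0 < eta)%R ->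
  exists2 eps : R, (0 < eps)%R & forall i U, is_open_cover U ->
    (cover_diam U < eps)%R -> lower_Pcover T E i U <= lower_P T E + eta%:E.
Proof.
move=> eta0; have [eps e0 P32] := lower_P3_le_P2 eta eta0.
exists eps => // i U oU Ueps.
have P4 := le_trans (lower_P4_le_Q U oU) lower_Q_le_P.
have P2 := le_trans (lower_P2_le_P4 U oU) P4.
have P3 : lower_Pcover T E v3 U <= lower_P T E + eta%:E.
  by rewrite (le_trans (P32 U oU Ueps))// addeC leeD2r.
have Peta : lower_P T E <= lower_P T E + eta%:E by rewrite leeDl// lee_fin ltW.
case: i.
- exact: le_trans (lower_P1_le_P3 U oU) P3.
- exact: le_trans P2 Peta.
- exact: P3.
- exact: le_trans P4 Peta.
Qed.

Lemma lower_Pcover_ge (eta eps : R) : (0 < eta)%R -> (0 < eps)%R ->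
  exists2 d : R, (0 < d)%R & forall i U, is_open_cover U ->
    (cover_diam U < d)%R ->
    lower_rate (Psep T E eps) <= eta%:E + lower_Pcover T E i U.
Proof.
move=> eta0 e0; have [d d0 P32] := lower_P3_le_P2 eta eta0.
(* Below [eps] the cover distinguishes separated points; below [d] passing from [v3] to [v2] costs
   only [eta]. *)
exists (Num.min d eps); first by rewrite lt_min d0.
move=> i U oU; rewrite lt_min => /andP[Ud Ueps].
have P1 := lower_Psep_le_P1 U eps oU Ueps.
have P3 := le_trans P1 (lower_P1_le_P3 U oU).
have P2 := le_trans P3 (P32 U oU Ud).
have leeta (z : \bar R) : z <= eta%:E + z by rewrite leeDr// lee_fin ltW.
case: i.
- exact: le_trans P1 (leeta _).
- exact: P2.
- exact: le_trans P3 (leeta _).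
- by apply: le_trans P2 _; apply: leeD2l; exact: lower_P2_le_P4.
Qed.

(** The comparison passes through [v4] for one open cover of small diameter. *)
Lemma lower_P_le_Q : lower_P T E <= lower_Q T E.
Proof.
rewrite lower_P_sup; apply: ge_ereal_sup => _ [eps /= e0 <-].
apply/lee_addgt0Pr => eta eta0.
have [d d0 H] := lower_Pcover_ge eta eps eta0 e0.
have d20 : (0 < d / 2)%R by rewrite divr_gt0.
have [U oU Ud] := exists_small_open_cover cX (d / 2) d20.
rewrite (le_trans (H v4 U oU _)) 1?addeC ?leeD2r ?lower_P4_le_Q//.
by rewrite (le_lt_trans Ud)// gtr_pMr// invf_lt1// ltr1n.
Qed.

(** An open cover of diameter below a Lebesgue number of [U] refines [U], and [p1] grows under
    refinement, so the bound for small covers carries over to [U]. *)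
Lemma lower_P1_le U : is_open_cover U -> lower_Pcover T E v1 U <= lower_P T E.
Proof.
move=> oU; apply/lee_addgt0Pr => eta eta0.
have [eps e0 Ueps] := lebesgue_number cX U oU.
have [d d0 H] := lower_Pcover_le eta eta0.
have m0 : (0 < Num.min d eps / 2)%R by rewrite divr_gt0// lt_min d0.
have [V oV] := exists_small_open_cover cX _ m0.
move=> /le_lt_trans/(_ (_ : (_ < Num.min d eps)%R)).
rewrite gtr_pMr ?lt_min ?d0// invf_lt1// ltr1n => /(_ isT)/andP[Vd Veps].
apply: le_trans (H v1 V oV Vd); apply: lower_P1_refines.
by apply: (refines_small cX U V eps) => //; case: oV => -[].
Qed.

End pressure_comparison.

Theorem theorem4p8 (R : realType) (X : pmetricType R) (T : X -> X)
    (E : prob_space X -> R) :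
  compact [set: X] -> continuous T -> set_surj [set: X] [set: X] T ->
  continuous E ->
  [/\ lower_Q T E = lower_P T E,
      forall i : variant,
        ereal_sup [set lower_Pcover T E i U | U in
          [set U | is_open_cover U /\ cover_diam U <= delta]]
        @[delta --> 0^'+] --> lower_P T E,
      forall (i : variant) (U : nat -> set (set X)),
        (forall k, is_open_cover (U k)) ->
        cover_diam (U k) @[k --> \oo] --> (0 : R) ->
        lower_Pcover T E i (U k) @[k --> \oo] --> lower_P T E &
      forall i : variant, i = v1 \/ i = v2 \/ i = v4 ->
        ereal_sup [set lower_Pcover T E i U | U in
          [set U | is_open_cover U]] = lower_P T E].
Proof.
move=> cX cT _ cE.
have QP : lower_Q T E = lower_P T E.
  by apply/eqP; rewrite eq_le lower_Q_le_P lower_P_le_Q.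
split=> //.
- move=> i; rewrite lower_P_sup; apply: cvge_sup_squeeze.
    move=> eta eta0; rewrite -lower_P_sup.
    have [d d0 H] := lower_Pcover_le T E cX cT cE eta eta0.
    near=> delta; apply: ge_ereal_sup => _ [U [oU Ud] <-]; apply: H => //.
    by rewrite (le_lt_trans Ud)//; near: delta; exact: nbhs_right_lt.
  move=> _ [eps /= e0 <-] eta eta0.
  have [d d0 H] := lower_Pcover_ge T E cX cT cE eta eps eta0 e0.
  near=> delta.
  (* A single cover of diameter at most [delta] already bounds the supremum from below. *)
  have [U oU Ud] : exists2 U : set (set X), is_open_cover U & cover_diam U <= delta.
    exact: exists_small_open_cover.
  apply: (@le_trans _ _ (eta%:E + lower_Pcover T E i U)%E).
    apply: H => //.
    by rewrite (le_lt_trans Ud)//; near: delta; exact: nbhs_right_lt.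
  by rewrite leeD2l//; apply: ereal_sup_ubound; exists U.
- move=> i U oU U0; rewrite lower_P_sup; apply: cvge_sup_squeeze.
    move=> eta eta0; rewrite -lower_P_sup.
    have [d d0 H] := lower_Pcover_le T E cX cT cE eta eta0.
    have /cvgrPdist_lt/(_ d d0) := U0; apply: filterS => k.
    by rewrite sub0r normrN => /(le_lt_trans (ler_norm _)); exact: H.
  move=> _ [eps /= e0 <-] eta eta0.
  have [d d0 H] := lower_Pcover_ge T E cX cT cE eta eps eta0 e0.
  have /cvgrPdist_lt/(_ d d0) := U0; apply: filterS => k.
  by rewrite sub0r normrN => /(le_lt_trans (ler_norm _)); exact: H.
- move=> i i124; apply/eqP; rewrite eq_le; apply/andP; split.
    (* Here [U] need not be small: [v4], and with it [v2], stays below [lower_Q] for every open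
       cover, while [v1] goes through a refinement. *)
    apply: ge_ereal_sup => _ [U oU <-].
    have P4 : (lower_Pcover T E v4 U <= lower_P T E)%E.
      by rewrite -QP; exact: lower_P4_le_Q.
    case: i124 => [->|[->|-> //]]; first exact: lower_P1_le.
    by apply: le_trans P4; exact: lower_P2_le_P4.
  rewrite lower_P_sup; apply: ge_ereal_sup => _ [eps /= e0 <-].
  apply/lee_addgt0Pr => eta eta0.
  have [d d0 H] := lower_Pcover_ge T E cX cT cE eta eps eta0 e0.
  (* Small covers come with a weak bound on the diameter; halving [d] makes it strict. *)
  have d20 : 0 < d / 2 by rewrite divr_gt0.
  have [U oU Ud] := exists_small_open_cover cX (d / 2) d20.
  have dd : cover_diam U < d by lra.
  rewrite (le_trans (H i U oU dd))// addeC leeD2r//.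
  by apply: ereal_sup_ubound; exists U.
Unshelve. all: by end_near. Qed.
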